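(* Let $\mathcal{H}$ be a complex Hilbert space, and let $A_i\ge 0$, $B_i\ge 0$ ($i=1,2,\dots$) be positive bounded operators on $\mathcal{H}$ such that $\sum_{i=1}^\infty\|A_i\|^2<\infty$ and $\sum_{i=1}^\infty\|B_i\|^2<\infty$. Let $\Delta: B(\mathcal{H})\to B(\mathcal{H})$ be given by $\Delta(X)=\sum_{i=1}^\infty A_iXB_i$. If $A_iA_j=A_jA_i$ for all $i,j$, then $\sigma(\Delta)\subset\mathbb{R}_+$.
   Context: $B(\mathcal{H})$ is the algebra of bounded linear operators on $\mathcal{H}$, $\mathbb{R}_+=[0,+\infty)$, and $\sigma(\Delta)$ is the spectrum of $\Delta$ as a bounded linear operator on the Banach space $B(\mathcal{H})$. *)

(* Defs.v *)
From HB Require Import structures.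
From mathcomp Require Import all_boot all_order all_algebra.
From mathcomp Require Import all_classical all_reals all_analysis.
From mathcomp Require Import complex ring.

Set Implicit Arguments.
Unset Strict Implicit.
Unset Printing Implicit Defensive.

Import Order.TTheory GRing.Theory Num.Theory.
Import numFieldNormedType.Exports.

Local Open Scope complex_scope.
Local Open Scope classical_set_scope.
Local Open Scope ring_scope.

(* In a normed space over [R[i]] the library norm [`|x|] takes values in
   [R[i]] (with zero imaginary part); [rnorm x] is the same number in [R]. *)
Definition rnorm (R : realType) (V : normedModType R[i]) (x : V) : R :=
  complex.Re `|x|.

Section Rnorm.
Variables (R : realType) (V : normedModType R[i]).
Implicit Types x y : V.

Lemma rnormE x : `|x| = (rnorm x)%:C.
Proof.
have := normr_ge0 x; rewrite /rnorm; case: `|x| => a b /=.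
by rewrite lecE /= => /andP[/eqP -> _].
Qed.

Lemma rnorm_ge0 x : 0 <= rnorm x.
Proof. by rewrite -lecR -rnormE normr_ge0. Qed.

Lemma rnorm0 : rnorm (0 : V) = 0.
Proof. by rewrite /rnorm normr0. Qed.

Lemma rnorm_eq0 x : rnorm x = 0 -> x = 0.
Proof. by move=> x0; apply/normr0_eq0; rewrite rnormE x0. Qed.

Lemma rnormD x y : rnorm (x + y) <= rnorm x + rnorm y.
Proof. by rewrite -lecR rmorphD /= -!rnormE ler_normD. Qed.

Lemma rnormZ (l : R[i]) x : rnorm (l *: x) = complex.Re `|l| * rnorm x.
Proof.
by rewrite /rnorm normrZ (rnormE x) normc_def /= mulr0 subr0.
Qed.

Lemma rnormZr (r : R) x : 0 <= r -> rnorm (r%:C *: x) = r * rnorm x.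
Proof. by move=> r0; rewrite rnormZ ger0_norm// lecR. Qed.

End Rnorm.

Section BoundedOperators.
Variables (R : realType) (V W : normedModType R[i]).

(* [`|x|] = [(rnorm x)%:C], so [exists M] is the usual boundedness of [f];
   [bop] is carved out of the module of all functions [V -> W], hence has
   pointwise addition and scaling. *)
Definition bounded_linear : {pred V -> W} := [pred f : V -> W |
  `[< linear f /\ exists M : R, forall x, rnorm (f x) <= M * rnorm x >]].

Record bop := Bop { bop_fun :> V -> W; _ : bop_fun \in bounded_linear }.

HB.instance Definition _ := [isSub for bop_fun].
HB.instance Definition _ := [Choice of bop by <:].

Lemma bounded_linear_submod : submod_closed bounded_linear.
Proof.
split.
  apply/asboolP; split; first by move=> a x y /=; rewrite scaler0 addr0.
  by exists 0 => x; rewrite mul0r rnorm0.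
move=> a f g /asboolP[lf [M hM]] /asboolP[lg [N hN]]; apply/asboolP; split.
  move=> b x y; rewrite /= !fctE lf lg !scalerDr !scalerA addrACA.
  by rewrite (mulrC a b) .
exists (complex.Re `|a| * M + N) => x.
rewrite (le_trans (rnormD _ _))// mulrDl lerD// rnormZ -mulrA ler_wpM2l//.
by rewrite -lecR -(@rnormE _ R[i]^o) normr_ge0.
Qed.

HB.instance Definition _ := GRing.isSubmodClosed.Build _ _ bounded_linear
  bounded_linear_submod.
HB.instance Definition _ := [SubChoice_isSubLmodule of bop by <:].

Lemma bop_linear (f : bop) : linear f.
Proof. by case: f => f /= /asboolP[]. Qed.

HB.instance Definition _ (f : bop) :=
  GRing.isLinear.Build R[i] V W *:%R (bop_fun f) (bop_linear f).

Definition opnorm (f : bop) : R :=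
  sup [set rnorm (f x) | x in [set x | rnorm x <= 1]].


Lemma opnorm_has_sup (f : bop) :
  has_sup [set rnorm (f x) | x in [set x | rnorm x <= 1]].
Proof.
split; first by exists (rnorm (f 0)); exists 0 => //=; rewrite rnorm0.
case: f => f /= /[dup] /asboolP[_ [M hM]] _.
exists (Num.max M 0) => _ [x /= x1 <-]; rewrite (le_trans (hM x))//.
rewrite (@le_trans _ _ (Num.max M 0 * rnorm x))//.
  by rewrite ler_wpM2r ?rnorm_ge0// le_max lexx.
by rewrite ler_piMr// le_max lexx orbT.
Qed.

Lemma opnorm_ge0 (f : bop) : 0 <= opnorm f.
Proof.
apply: (@le_trans _ _ (rnorm (f 0))); first exact: rnorm_ge0.
apply: sup_upper_bound; first exact: opnorm_has_sup.
by exists 0 => //=; rewrite rnorm0.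
Qed.

Lemma opnormP (f : bop) x : rnorm (f x) <= opnorm f * rnorm x.
Proof.
have [x0|x0] := eqVneq (rnorm x) 0.
  by rewrite x0 mulr0 (rnorm_eq0 x0) linear0 rnorm0.
have x_gt0 : 0 < rnorm x by rewrite lt_neqAle eq_sym x0 rnorm_ge0.
rewrite -ler_pdivrMr// mulrC -rnormZr ?invr_ge0 ?rnorm_ge0// -linearZ.
apply: sup_upper_bound; first exact: opnorm_has_sup.
exists ((rnorm x)^-1%:C *: x) => //=.
by rewrite rnormZr ?invr_ge0 ?rnorm_ge0// mulVf.
Qed.

Lemma opnorm_le (f : bop) M : 0 <= M ->
  (forall x, rnorm (f x) <= M * rnorm x) -> opnorm f <= M.
Proof.
move=> M0 hM; apply: ge_sup; first by have [] := opnorm_has_sup f.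
by move=> _ [x /= x1 <-]; rewrite (le_trans (hM x))// ler_piMr.
Qed.

Lemma bopP (f g : bop) : (forall x, f x = g x) -> f = g.
Proof. by move=> fg; apply/val_inj/funext. Qed.

Lemma bop0E x : (0 : bop) x = 0. Proof. by []. Qed.
Lemma bopDE (f g : bop) x : (f + g) x = f x + g x. Proof. by []. Qed.
Lemma bopNE (f : bop) x : (- f) x = - f x. Proof. by []. Qed.
Lemma bopZE a (f : bop) x : (a *: f) x = a *: f x. Proof. by []. Qed.

Lemma bop_ler_normD (f g : bop) :
  (opnorm (f + g))%:C <= (opnorm f)%:C + (opnorm g)%:C.
Proof.
rewrite -rmorphD lecR; apply: opnorm_le; first by rewrite addr_ge0 ?opnorm_ge0.
move=> x; rewrite bopDE (le_trans (rnormD _ _))// mulrDl.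
by rewrite lerD ?opnormP.
Qed.

Lemma bop_normr0_eq0 (f : bop) : (opnorm f)%:C = 0 -> f = 0.
Proof.
case=> f0; apply: bopP => x; rewrite bop0E; apply/rnorm_eq0/le_anti.
by rewrite rnorm_ge0 andbT (le_trans (opnormP f x))// f0 mul0r.
Qed.

Lemma bop_normrZ (a : R[i]) (f : bop) :
  (opnorm (a *: f))%:C = `|a| * (opnorm f)%:C.
Proof.
have ale b (g : bop) : opnorm (b *: g) <= complex.Re `|b| * opnorm g.
  have b0 : 0 <= complex.Re `|b| by rewrite -lecR -(@rnormE _ R[i]^o) normr_ge0.
  apply: opnorm_le => [|x]; first by rewrite mulr_ge0 ?opnorm_ge0.
  by rewrite bopZE rnormZ -mulrA ler_wpM2l ?opnormP.
rewrite (@rnormE _ R[i]^o a) -rmorphM; congr (_%:C).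
apply/eqP; rewrite eq_le ale /=.
have [->|a0] := eqVneq a 0; first by rewrite rnorm0 mul0r opnorm_ge0.
have ra0 : 0 < rnorm (a : R[i]^o).
  by rewrite -ltcR -rnormE normr_gt0.
rewrite -ler_pdivlMl//; have := ale a^-1 (a *: f).
by rewrite scalerA mulVf// scale1r normfV (@rnormE _ R[i]^o a) -fmorphV.
Qed.

(* The topology on [bop V W] is the one induced by the operator norm. *)
HB.instance Definition _ := Lmodule_isNormed.Build R[i] bop
  bop_ler_normD bop_normrZ bop_normr0_eq0.

Lemma bop_normE (f : bop) : `|f| = (opnorm f)%:C. Proof. by []. Qed.

Lemma bop_rnormE (f : bop) : rnorm f = opnorm f. Proof. by []. Qed.

End BoundedOperators.

Section BopComplete.
Variables (R : realType) (V : normedModType R[i]) (W : completeNormedModType R[i]).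

Lemma bop_complete (F : set_system (bop V W)) :
  ProperFilter F -> cauchy F -> cvg F.
Proof.
move=> FF /cauchyP Fc.
have Fr (r : R) : 0 < r ->
    exists f0 : bop V W,
      F [set f : bop V W | forall x, rnorm (f0 x - f x) <= r * rnorm x].
  rewrite -ltcR => /Fc[f0 Ff0]; exists f0; apply: filterS Ff0 => f /=.
  rewrite -ball_normE /= bop_normE ltcR => /ltW fr x.
  by rewrite (le_trans (opnormP (f0 - f) x))// ler_wpM2r ?rnorm_ge0.
have ptc x : cvg ((fun f : bop V W => f x) @ F).
  apply: cauchy_cvg; apply: cauchy_exP => e e0.
  have eE : e = (rnorm (e : R[i]^o))%:C by rewrite -rnormE gtr0_norm.
  have r0 : 0 < rnorm (e : R[i]^o) by rewrite -ltcR -eE.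
  have x1 : 0 < rnorm x + 1 by rewrite ltr_pwDr ?rnorm_ge0.
  have [f0 Ff0] := Fr _ (divr_gt0 r0 x1).
  exists (f0 x); change (F [set f : bop V W | ball (f0 x) e (f x)]).
  apply: filterS Ff0 => f /= /(_ x) fx.
  rewrite -ball_normE /= rnormE eE ltcR (le_lt_trans fx)//.
  by rewrite -mulrA gtr_pMr// mulrC ltr_pdivrMr// mul1r ltrDl.
pose g x : W := lim ((fun f : bop V W => f x) @ F).
have gE x : (fun f : bop V W => f x) @ F --> g x by exact: ptc.
have glin : linear g.
  move=> a x y; apply/cvg_lim; first exact: norm_hausdorff.
  rewrite (_ : (fun f : bop V W => f (a *: x + y)) =
               (fun f : bop V W => a *: f x + f y)).
    by apply: cvgD (gE y); apply: cvgZr (gE x).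
  by apply/funext => f; rewrite linearP.
have gle (r : R) (f0 : bop V W) x :
    F [set f : bop V W | forall x, rnorm (f0 x - f x) <= r * rnorm x] ->
    rnorm (f0 x - g x) <= r * rnorm x.
  move=> Ff0; apply/ler_addgt0Pr => d d0.
  have Fd : F [set f : bop V W | rnorm (g x - f x) < d].
    have /cvgrPdist_lt := gE x; move=> /(_ d%:C); rewrite ltcR => /(_ d0).
    by apply: filterS => f /=; rewrite rnormE ltcR.
  have [f [/= /(_ x) f0f fg]] := filter_ex (filterI Ff0 Fd).
  have -> : f0 x - g x = (f0 x - f x) + - (g x - f x).
    by rewrite opprB addrA subrK.
  rewrite (le_trans (rnormD _ _))// lerD//.
  by rewrite /rnorm normrN ltW.
have gB : g \in @bounded_linear R V W.
  apply/asboolP; split=> //; have [f0 Ff0] := Fr 1 ltr01.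
  exists (opnorm f0 + 1) => x.
  have -> : g x = f0 x + - (f0 x - g x) by rewrite opprB addrC subrK.
  rewrite (le_trans (rnormD _ _))// mulrDl lerD ?opnormP//.
  by rewrite /rnorm normrN; exact: gle.
apply/cvg_ex; exists (Bop gB); apply/cvgrPdist_le => e e0.
have eE : e = (rnorm (e : R[i]^o))%:C by rewrite -rnormE gtr0_norm.
have r0 : 0 < rnorm (e : R[i]^o) / 2.
  by rewrite divr_gt0// -ltcR -eE.
have [f0 Ff0] := Fr _ r0.
apply: filterS (Ff0) => f /= f0f.
rewrite bop_normE eE lecR; apply: opnorm_le; first exact: rnorm_ge0.
move=> x; rewrite bopDE bopNE /=.
have -> : g x - f x = (f0 x - f x) + - (f0 x - g x).
  by rewrite opprB [RHS]addrC addrA subrK.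
rewrite (le_trans (rnormD _ _))// (splitr (rnorm e)) mulrDl lerD//.
by rewrite [leLHS]/rnorm normrN; exact: gle.
Qed.

HB.instance Definition _ := Uniform_isComplete.Build (bop V W) bop_complete.

End BopComplete.

Section Composition.
Variables (R : realType) (U V W : normedModType R[i]).

Lemma bop_comp_subproof (f : bop V W) (g : bop U V) :
  (fun x => f (g x)) \in @bounded_linear R U W.
Proof.
apply/asboolP; split; first by move=> a x y; rewrite !linearP.
exists (opnorm f * opnorm g) => x; rewrite (le_trans (opnormP f _))//.
by rewrite -mulrA ler_wpM2l ?opnormP ?opnorm_ge0.
Qed.

Definition bop_comp (f : bop V W) (g : bop U V) : bop U W :=
  Bop (bop_comp_subproof f g).

Lemma opnorm_comp f g : opnorm (bop_comp f g) <= opnorm f * opnorm g.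
Proof.
apply: opnorm_le => [|x]; first by rewrite mulr_ge0 ?opnorm_ge0.
rewrite (le_trans (opnormP f _))//.
by rewrite -mulrA ler_wpM2l ?opnormP ?opnorm_ge0.
Qed.

Lemma bop_id_subproof : (fun x => x) \in @bounded_linear R V V.
Proof. by apply/asboolP; split=> //; exists 1 => x; rewrite mul1r. Qed.

Definition bop_id : bop V V := Bop bop_id_subproof.

End Composition.
Arguments bop_id {R V}.

Notation "''B(' V )" := (bop V V) (format "''B(' V )") : type_scope.
Notation "f \ob g" := (bop_comp f g)
  (at level 40, left associativity) : ring_scope.

(* [l] is in the spectrum iff [T - l] has no inverse in the algebra ['B(E)] *)
Definition spectrum (R : realType) (E : normedModType R[i]) (T : 'B(E)) :
    set R[i] :=
  [set l | ~ exists S : 'B(E),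
     (T - l *: bop_id) \ob S = bop_id /\ S \ob (T - l *: bop_id) = bop_id].

(* [0 <= z] in [R[i]] means that [z] is real and nonnegative; on a complex
   Hilbert space this forces [A] to be self-adjoint. *)
Definition positive_op (R : realType) (H : normedModType R[i])
    (dot : {dot H for Num.conj}) (A : 'B(H)) : Prop :=
  forall x, 0 <= dot (A x) x.

(* [Delta X = \sum_i A i X B i], as a series converging in operator norm *)
Definition is_elementary_op (R : realType) (H : normedModType R[i])
    (A B : nat -> 'B(H)) (Delta : 'B('B(H))) : Prop :=
  forall X : 'B(H), series (fun i => A i \ob X \ob B i) @ \oo --> Delta X.

(* Square-summability of the norms makes the series converge in norm to a
   bounded operator on ['B(H)], so [is_elementary_op] is satisfiable; [Delta]
   is unique, limits in ['B(H)] being unique. *)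
Lemma elementary_op_exists (R : realType) (H : completeNormedModType R[i])
    (A B : nat -> 'B(H)) :
  cvgn (series (fun i => opnorm (A i) ^+ 2)) ->
  cvgn (series (fun i => opnorm (B i) ^+ 2)) ->
  exists Delta : 'B('B(H)), is_elementary_op A B Delta.
Proof.
move=> cA cB; pose c i : R := opnorm (A i) ^+ 2 + opnorm (B i) ^+ 2.
have c0 i : 0 <= c i by rewrite addr_ge0 ?sqr_ge0.
have cc : cvgn (series c) by exact: is_cvg_seriesD cA cB.
have tm i X : opnorm (A i \ob X \ob B i) <= c i * opnorm X.
  rewrite (le_trans (opnorm_comp _ _))//.
  rewrite (@le_trans _ _ (opnorm (A i) * opnorm X * opnorm (B i)))//.
    by rewrite ler_wpM2r ?opnorm_ge0// opnorm_comp.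
  rewrite mulrAC ler_wpM2r ?opnorm_ge0// /c.
  rewrite -subr_ge0 (_ : _ - _ = (opnorm (A i) - opnorm (B i)) ^+ 2 +
    opnorm (A i) * opnorm (B i)); last by ring.
  by rewrite addr_ge0 ?sqr_ge0// mulr_ge0 ?opnorm_ge0.
have sm X m n : rnorm (\sum_(m <= k < n) (A k \ob X \ob B k)) <=
    (\sum_(m <= k < n) c k) * opnorm X.
  elim/big_rec2: _ => [|i y1 y2 _ IH]; first by rewrite rnorm0 mul0r.
  by rewrite (le_trans (rnormD _ _))// mulrDl lerD// tm.
have cD X : cvgn (series (fun i => A i \ob X \ob B i)).
  apply: cauchy_cvg; apply/cauchy_seriesP => e e0.
  have eE : e = (rnorm (e : R[i]^o))%:C by rewrite -rnormE gtr0_norm.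
  have r0 : 0 < rnorm (e : R[i]^o) by rewrite -ltcR -eE.
  have X1 : 0 < opnorm X + 1 by rewrite ltr_pwDr ?opnorm_ge0.
  have /cauchy_cvgP/cauchy_seriesP/(_ _ (divr_gt0 r0 X1)) := cc.
  apply: filterS => -[m n] /= h.
  rewrite rnormE eE ltcR (le_lt_trans (sm X m n))//.
  have s0 : 0 <= \sum_(m <= k < n) c k by rewrite sumr_ge0.
  move: h; rewrite ger0_norm// ltr_pdivlMr//; apply: le_lt_trans.
  by rewrite ler_wpM2l// lerDl.
pose D X : 'B(H) := limn (series (fun i => A i \ob X \ob B i)).
have Dlin : linear D.
  move=> a X Y; apply/cvg_lim; first exact: norm_hausdorff.
  rewrite (_ : series _ = (fun n => a *: series (fun i => A i \ob X \ob B i) n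
     + series (fun i => A i \ob Y \ob B i) n)).
    by apply: cvgD (cD Y); apply: cvgZr (cD X).
  apply/funext => n; rewrite /series /= scaler_sumr -big_split /=.
  by apply: eq_bigr => i _; apply: bopP => x; rewrite /= linearP.
have DB : D \in @bounded_linear R 'B(H) 'B(H).
  apply/asboolP; split=> //; exists (limn (series c)) => X.
  rewrite bop_rnormE; apply/ler_addgt0Pr => d d0.
  have /cvgrPdist_lt := cD X; move=> /(_ d%:C); rewrite ltcR => /(_ d0).
  case=> N _ /(_ N (leqnn N)) /=.
  rewrite -[X in (`|X - _|)]/(D X) rnormE ltcR => DN.
  set S := series _ N in DN.
  have -> : opnorm (D X) = rnorm (S + (D X - S)) by rewrite addrC subrK.
  rewrite (le_trans (rnormD _ _))// lerD//; last exact: ltW.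
  rewrite (le_trans (sm X 0%N N))// ler_wpM2r ?opnorm_ge0//.
  apply: nondecreasing_cvgn_le => //; apply: nondecreasing_series => i _ _.
  exact: c0.
by exists (Bop DB) => X; exact: cD.
Qed.

(* Main.v *)
Require Import Defs.
From mathcomp Require Import all_boot all_order all_algebra.
From mathcomp Require Import all_classical all_reals all_analysis.
From mathcomp Require Import complex ring lra.

(** Lower bounds are enough to get inverses: if [Delta - l] is bounded below for
    every [l] outside [0, +oo[, then, for each such [l], so is
    [u Delta - l] for every [u] in [0, 1], and invertibility propagates from
    [u = 0] to [u = 1] ([surjective_continuation], [spectrum_sub_half_line]).
    So it suffices to bound [Delta - l] below.

    Suppose that [X] is an approximate eigenvector of [Delta] for [l]. Since the
    [A i] commute with each other, left multiplication by [A i] commutes with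
    [Delta] ([elementary_op_comm]); hence [X] may be chosen to be an approximate
    eigenvector of the left multiplications by [A 0], ..., [A (N - 1)] as well,
    for some eigenvalues [t i >= 0]. Then [Delta X] is close to [X C] with
    [C = \sum_i (t i) (B i)], up to a tail of the series that is small because the
    norms are square-summable. But [C] is positive, so [X (C - l)] cannot be small
    when [l] is off the half-line ([local_lower_bound]). The operators [B i] do
    not have to commute, since only one numerical combination of them occurs.

    The passage to joint approximate eigenvectors is made quantitative, with lower
    bounds instead of sequences ([bounded_below_of_joint], by induction from
    [bounded_below_of_local]): a seminorm [p] is bounded below as soon as
    [|A X - t X| + p X] is bounded below for each [t >= 0]. For this the vector is
    decomposed along the spectrum of [A] by the Bernstein partition of unity
    [1 = \sum_k b_k(A)]. No functional calculus beyond polynomials is used: the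
    operators [b_k(A)] are positive for algebraic reasons, and the fourth moment
    of the binomial law gives [|(A - k/n)^4 b_k(A)| <= n^-2]
    ([bernstein_localised]), which is summable against the [n + 1] terms. *)

Set Implicit Arguments.
Unset Strict Implicit.
Unset Printing Implicit Defensive.

Import Order.TTheory GRing.Theory Num.Theory.
Import numFieldNormedType.Exports.

Local Open Scope complex_scope.
Local Open Scope classical_set_scope.
Local Open Scope ring_scope.

(** * Real-valued norms *)

Section RealNorm.
Variables (R : realType) (V : normedModType R[i]).
Implicit Types x y : V.

Lemma rnormN x : rnorm (- x) = rnorm x.
Proof. by rewrite /rnorm normrN. Qed.

Lemma rnormB x y : rnorm (x - y) <= rnorm x + rnorm y.
Proof. by rewrite -(rnormN y) rnormD. Qed.

Lemma rnorm_sum (I : Type) (r : seq I) (P : pred I) (F : I -> V) :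
  rnorm (\sum_(i <- r | P i) F i) <= \sum_(i <- r | P i) rnorm (F i).
Proof.
elim/big_rec2: _ => [|i a b _ le_ab]; first by rewrite rnorm0.
by rewrite (le_trans (rnormD _ _))// lerD2l.
Qed.

Lemma cvg_rnorm (u : nat -> V) (l : V) : u @ \oo --> l ->
  forall e : R, 0 < e -> \forall n \near \oo, rnorm (l - u n) < e.
Proof.
move=> /cvgrPdist_lt ul e; rewrite -ltcR => /ul; apply: filterS => n.
by rewrite rnormE ltcR.
Qed.

End RealNorm.

Definition bounded_below (R : realType) (V : normedModType R[i]) (p : V -> R) :=
  exists2 c : R, 0 < c & forall x, c * rnorm x <= p x.

(** * Composition of bounded operators *)

Section Composition.
Variables (R : realType) (V : normedModType R[i]).
Implicit Types f g h : 'B(V).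

Lemma bop_compA f g h : f \ob (g \ob h) = f \ob g \ob h.
Proof. exact: bopP. Qed.

Lemma bop_comp1l f : (bop_id : 'B(V)) \ob f = f. Proof. exact: bopP. Qed.

Lemma bop_comp1r f : f \ob (bop_id : 'B(V)) = f. Proof. exact: bopP. Qed.

Lemma bop_comp0l f : (0 : 'B(V)) \ob f = 0. Proof. exact: bopP. Qed.

Lemma bop_comp0r f : f \ob (0 : 'B(V)) = 0.
Proof. by apply: bopP => x; rewrite /= linear0. Qed.

Lemma bop_compDl f g h : (f + g) \ob h = f \ob h + g \ob h.
Proof. exact: bopP. Qed.

Lemma bop_compDr f g h : f \ob (g + h) = f \ob g + f \ob h.
Proof. by apply: bopP => x; rewrite /= linearD. Qed.

Lemma bop_compBl f g h : (f - g) \ob h = f \ob h - g \ob h.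
Proof. exact: bopP. Qed.

Lemma bop_compBr f g h : f \ob (g - h) = f \ob g - f \ob h.
Proof. by apply: bopP => x; rewrite /= linearB. Qed.

Lemma bop_compZl a f g : (a *: f) \ob g = a *: (f \ob g).
Proof. exact: bopP. Qed.

Lemma bop_compZr a f g : f \ob (a *: g) = a *: (f \ob g).
Proof. by apply: bopP => x; rewrite /= linearZ. Qed.

Lemma bop_comp_suml (I : Type) (r : seq I) (P : pred I) (F : I -> 'B(V)) g :
  (\sum_(i <- r | P i) F i) \ob g = \sum_(i <- r | P i) (F i \ob g).
Proof.
by elim/big_rec2: _ => [|i a b _ <-]; rewrite ?bop_comp0l// bop_compDl.
Qed.

Lemma bop_comp_sumr (I : Type) (r : seq I) (P : pred I) (F : I -> 'B(V)) f :
  f \ob (\sum_(i <- r | P i) F i) = \sum_(i <- r | P i) (f \ob F i).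
Proof.
by elim/big_rec2: _ => [|i a b _ <-]; rewrite ?bop_comp0r// bop_compDr.
Qed.

End Composition.

(** * Surjectivity of operators that stay bounded below *)

Section Inverse.
Variables (R : realType) (V : normedModType R[i]) (T : 'B(V)).

(** The constant is kept in the conclusion: it is the quantitative bound on the
    resolvent of a positive operator that makes the choice of a truncation of
    the series for [Delta] independent of the coefficients [t_i]. *)
Lemma bop_inverse (c : R) : 0 < c ->
  (forall x, c * rnorm x <= rnorm (T x)) -> (forall y, exists x, T x = y) ->
  exists S, [/\ T \ob S = bop_id, S \ob T = bop_id
              & forall y, c * rnorm (S y) <= rnorm y].
Proof.
move=> c0 Tc Ts; pose g y := xget 0 [set x | T x = y].
have Tg y : T (g y) = y by have /(xgetPex 0) := Ts y.
have Tinj x x' : T x = T x' -> x = x'.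
  move=> Txx; apply/eqP; rewrite -subr_eq0; apply/eqP/rnorm_eq0/le_anti.
  rewrite rnorm_ge0 andbT -(pmulr_rle0 _ c0) (le_trans (Tc _))//.
  by rewrite linearB /= Txx subrr rnorm0.
have gB : g \in @bounded_linear R V V.
  apply/asboolP; split; first by move=> a x y; apply: Tinj; rewrite linearP /= !Tg.
  by exists c^-1 => x; rewrite ler_pdivlMl// (le_trans (Tc _))// Tg.
exists (Bop gB); split; first by apply: bopP => x; exact: Tg.
- by apply: bopP => x; apply: Tinj; rewrite /= Tg.
- by move=> y; rewrite (le_trans (Tc _))//= Tg.
Qed.

End Inverse.

Section Neumann.
Variables (R : realType) (E : completeNormedModType R[i]).
Implicit Types T D : 'B(E).

Lemma rnorm_iter T n y : rnorm (iter n T y) <= opnorm T ^+ n * rnorm y.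
Proof.
elim: n => [|n IH]; first by rewrite expr0 mul1r.
rewrite iterS (le_trans (opnormP T _))// exprS -mulrA.
by rewrite ler_wpM2l ?opnorm_ge0.
Qed.

(** The Neumann series [\sum_n T^n y] is dominated by a geometric one. *)
Lemma neumann_solution T (y : E) : opnorm T < 1 -> exists z, z = y + T z.
Proof.
move=> T1; pose u n := iter n T y; pose s := series u.
have cs : cvgn s.
  apply: cauchy_cvg; apply/cauchy_seriesP => e e0.
  have eE : e = (rnorm (e : R[i]^o))%:C by rewrite -rnormE gtr0_norm.
  have r0 : 0 < rnorm (e : R[i]^o) by rewrite -ltcR -eE.
  have : cvgn (series (geometric (rnorm y) (opnorm T))).
    by apply: is_cvg_geometric_series; rewrite ger0_norm ?opnorm_ge0.
  move=> /cauchy_cvgP/cauchy_seriesP/(_ _ r0); apply: filterS => -[m n] /= h.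
  rewrite rnormE eE ltcR (le_lt_trans _ h)// (le_trans (rnorm_sum _ _ _))//.
  rewrite ger0_norm; last first.
    by rewrite sumr_ge0// => i _; rewrite mulr_ge0 ?rnorm_ge0 ?exprn_ge0 ?opnorm_ge0.
  by apply: ler_sum => i _; rewrite mulrC rnorm_iter.
exists (limn s); set z := limn s.
have sS n : s n.+1 = y + T (s n).
  by rewrite /s /series /= big_nat_recl// linear_sum.
apply/eqP; rewrite -subr_eq0; apply/eqP/rnorm_eq0/le_anti.
rewrite rnorm_ge0 andbT; apply/ler_addgt0Pr => e e0; rewrite add0r.
have e2 : 0 < e / 2 by rewrite divr_gt0.
have [N _ hN] := cvg_rnorm cs e2.
have -> : z - (y + T z) = (z - s N.+1) - T (z - s N).
  by rewrite sS linearB /= opprB !opprD !addrA subrK.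
rewrite (le_trans (rnormB _ _))// [leRHS]splitr lerD//.
  by apply/ltW/hN => /=; rewrite leqW.
rewrite (le_trans (opnormP T _))//.
apply: (@le_trans _ _ (rnorm (z - s N))).
  by rewrite ler_piMl ?rnorm_ge0// ltW.
by apply/ltW/hN => /=.
Qed.

(** With [S] the inverse of [T], the equation [(T + D) x = y] becomes
    [z = y - D S z] for [z = T x], and [D S] is a strict contraction. *)
Lemma surjective_perturbation T D (c : R) : 0 < c ->
  (forall x, c * rnorm x <= rnorm (T x)) -> (forall y, exists x, T x = y) ->
  opnorm D < c -> forall y, exists x, (T + D) x = y.
Proof.
move=> c0 Tc Ts Dc y; have [S [TS _ Sc]] := bop_inverse c0 Tc Ts.
have K1 : opnorm (- (D \ob S)) < 1.
  have -> : opnorm (- (D \ob S)) = opnorm (D \ob S).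
    by rewrite -!bop_rnormE rnormN.
  rewrite (@le_lt_trans _ _ (opnorm D / c)) ?ltr_pdivrMr ?mul1r//.
  apply: opnorm_le => [|x]; first by rewrite divr_ge0 ?opnorm_ge0 ?ltW.
  rewrite (le_trans (opnormP D _))// -mulrA ler_wpM2l ?opnorm_ge0//.
  by rewrite ler_pdivlMl.
have [z zE] := neumann_solution y K1; exists (S z).
rewrite bopDE; have /(congr1 (fun f : 'B(E) => f z)) /= -> := TS.
by rewrite {1}zE bopNE /= subrK.
Qed.

End Neumann.

Section Continuation.
Variable R : realType.

(** A lower bound [c] at [t] leaves the lower bound [c / 2] on a neighbourhood
    of [t], so compactness of the segment makes the bound uniform. *)
Lemma uniformly_bounded_below (V : normedModType R[i]) (g : R -> V -> R)
    (K a b : R) : 0 <= K ->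
  (forall s t x, g s x <= g t x + K * `|s - t| * rnorm x) ->
  (forall t, a <= t <= b -> bounded_below (g t)) ->
  exists2 c : R, 0 < c & forall t, a <= t <= b -> forall x, c * rnorm x <= g t x.
Proof.
move=> K0 gK gc; have /compact_near_coveringP cab := @segment_compact R a b.
have := cab R 0^'+ (fun c t => forall x, c * rnorm x <= g t x) _.
move=> /(_ _) [|c c0 hc].
- move=> t; rewrite /= in_itv /= => /gc[c c0 gct].
  have K1 : 0 < K + 1 by rewrite ltr_pwDr.
  near=> s d => x.
  have ds : d + K * `|t - s| <= c.
    rewrite (splitr c) lerD//.
      near: d; apply: nbhs_right_le; exact: divr_gt0.
    rewrite (@le_trans _ _ ((K + 1) * `|t - s|))//.
      by rewrite ler_wpM2r// lerDl.
    rewrite -ler_pdivlMl//; near: s; apply: cvgr_dist_le; first exact: cvg_id.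
    by rewrite mulr_gt0 ?invr_gt0// divr_gt0.
  have := le_trans (gct x) (gK t s x).
  rewrite -lerBlDr -mulrBl; apply: le_trans.
  by rewrite ler_wpM2r ?rnorm_ge0// lerBrDr.
- exists (c / 2); first exact: divr_gt0.
  move=> t tab; apply: (hc (c / 2)) => /=; last by [].
    rewrite sub0r normrN gtr0_norm ?divr_gt0// ltr_pdivrMr//.
    by rewrite mulr_natr mulr2n ltrDl.
  exact: divr_gt0.
Unshelve. all: end_near. Qed.

(** Method of continuity along the path [u T - l], which starts at the
    scalar operator [- l]: the uniform lower bound [c] lets one move the
    parameter [u] from 0 to 1 by [N] equal steps, each of which perturbs the
    operator by less than [c]. *)
Lemma surjective_continuation (E : completeNormedModType R[i]) (T : 'B(E))
    (l : R[i]) :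
  (forall u : R, 0 <= u <= 1 ->
     bounded_below (fun x => rnorm (u%:C *: T x - l *: x))) ->
  forall y, exists x, T x - l *: x = y.
Proof.
move=> Tl; pose g (u : R) (x : E) := rnorm (u%:C *: T x - l *: x).
have [s t x|c c0 gc] :=
    @uniformly_bounded_below E g (opnorm T) 0 1 (opnorm_ge0 T) _ Tl.
  rewrite /g; have -> : s%:C *: T x - l *: x =
      (t%:C *: T x - l *: x) + (s - t)%:C *: T x.
    by rewrite addrAC -scalerDl -rmorphD/= addrCA subrr addr0.
  rewrite (le_trans (rnormD _ _))// lerD2l rnormZ normc_def /= expr0n addr0.
  rewrite sqrtr_sqr (mulrC (opnorm T)) -mulrA ler_wpM2l//.
  exact: opnormP.
have [N N0 TN] : exists2 N : nat, (0 < N)%N & opnorm T / N%:R < c.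
  have [N hN] : exists N : nat, opnorm T / c < N%:R.
    exists (Num.bound (opnorm T / c)); apply: archi_boundP.
    by rewrite divr_ge0 ?opnorm_ge0 ?ltW.
  exists N; first by rewrite -(ltr_nat R) (le_lt_trans _ hN)// divr_ge0 ?opnorm_ge0 ?ltW.
  have N0 : 0 < N%:R :> R by rewrite (le_lt_trans _ hN)// divr_ge0 ?opnorm_ge0 ?ltW.
  by rewrite ltr_pdivrMr// mulrC -ltr_pdivrMr.
have N0' : 0 < N%:R :> R by rewrite ltr0n.
pose Tk k : 'B(E) := (k%:R / N%:R : R)%:C *: T - l *: bop_id.
have TkE k x : Tk k x = (k%:R / N%:R : R)%:C *: T x - l *: x by [].
suff Tks k : (k <= N)%N -> forall y, exists x, Tk k x = y.
  move=> y; have [x] := Tks _ (leqnn N) y.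
  by rewrite TkE divff ?gt_eqF// scale1r; exists x.
have Tkc n : (n <= N)%N -> forall x, c * rnorm x <= rnorm (Tk n x).
  by move=> nN; apply: gc; rewrite divr_ge0//= ler_pdivrMr// mul1r ler_nat nN.
elim: k => [_ y|n IH nN y].
  (* if [l = 0], the lower bound at [u = 0] forces the space to be trivial *)
  have [l0|l0] := eqVneq l 0.
    exists 0; rewrite linear0; apply/esym/rnorm_eq0/le_anti.
    rewrite rnorm_ge0 andbT -(pmulr_rle0 _ c0) (le_trans (Tkc 0%N _ _))//.
    by rewrite TkE l0 mul0r !scale0r subrr rnorm0.
  exists (- (l^-1 *: y)).
  by rewrite TkE mul0r scale0r sub0r scalerN opprK scalerA divff// scale1r.
have Dc : opnorm ((N%:R^-1 : R)%:C *: T) < c.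
  rewrite -bop_rnormE rnormZr ?invr_ge0 ?ltW// mulrC; exact: TN.
have [x xE] := surjective_perturbation c0 (Tkc _ (ltnW nN)) (IH (ltnW nN)) Dc y.
exists x; rewrite -xE bopDE !TkE bopZE -natr1 mulrDl mul1r rmorphD /= scalerDl.
by rewrite addrAC.
Qed.

End Continuation.

(** * Positive operators *)

Section PositiveOperators.
Variables (R : realType) (H : normedModType R[i]) (dot : {dot H for Num.conj}).
Hypothesis norm_dot : forall x : H, `|x| ^+ 2 = dot x x.
Implicit Types (A : 'B(H)) (x y : H).

Definition self_adjoint A := forall x y, dot (A x) y = dot x (A y).

Lemma dotC x y : dot x y = (dot y x)^*.
Proof. by rewrite hermC expr0 mul1r. Qed.

Lemma dotDl x y z : dot (x + y) z = dot x z + dot y z.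
Proof. exact: linearDl. Qed.
Lemma dotDr x y z : dot x (y + z) = dot x y + dot x z.
Proof. exact: linearDr. Qed.
Lemma dotBl x y z : dot (x - y) z = dot x z - dot y z.
Proof. exact: linearBl. Qed.
Lemma dotBr x y z : dot x (y - z) = dot x y - dot x z.
Proof. exact: linearBr. Qed.
Lemma dotZl a x y : dot (a *: x) y = a * dot x y.
Proof. exact: linearZl_LR. Qed.
Lemma dotZr a x y : dot x (a *: y) = a^* * dot x y.
Proof. exact: linearZr_LR. Qed.

(** Polarization: the sesquilinear form [s u v = <A u, v> - <u, A v>] vanishes
    on the diagonal since [<A u, u>] is real, and a sesquilinear form over the
    complex numbers is determined by its diagonal. *)
Lemma positive_self_adjoint A : positive_op dot A -> self_adjoint A.
Proof.
move=> A0 x y; have AZ a u : A (a *: u) = a *: A u by rewrite linearZ.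
pose s u v := dot (A u) v - dot u (A v).
have s0 u : s u u = 0.
  by rewrite /s (dotC u) (CrealP (ger0_real (A0 u))) subrr.
have sD u v : s u v + s v u = 0.
  have := s0 (u + v); rewrite /s !linearD /= !(dotDl, dotDr) => h.
  have := s0 u; have := s0 v; rewrite /s => hv hu.
  rewrite -[RHS]h -[LHS]addr0 -hu -[LHS]addr0 -hv.
  ring.
have sZr u v : s u ('i *: v) = - 'i * s u v.
  rewrite /s AZ !dotZr conjCi; ring.
have sZl u v : s ('i *: u) v = 'i * s u v.
  rewrite /s AZ !dotZl; ring.
have := sD x ('i *: y); rewrite sZr sZl => sDi.
have yx : s x y = s y x.
  apply: (mulfI (neq0Ci R[i])); apply/eqP; rewrite -subr_eq0 -oppr_eq0 opprB.
  by rewrite addrC -mulNr sDi.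
have : s x y *+ 2 = 0 by rewrite mulr2n {2}yx sD.
by move/eqP; rewrite mulrn_eq0 /= => /eqP/subr0_eq.
Qed.

Lemma dot_cauchy_schwarz x y : `|dot x y| <= `|x| * `|y|.
Proof.
have [->|y0] := eqVneq y 0; first by rewrite linear0r !normr0 mulr0.
rewrite -(@ler_pXn2r _ 2)// ?nnegrE ?mulr_ge0// exprMn (norm_dot x).
have N0 : 0 < `|y| ^+ 2 by rewrite exprn_gt0// normr_gt0.
rewrite -subr_ge0 -(pmulr_rge0 _ N0).
set N := `|y| ^+ 2 in N0 *; set d := dot x y.
have Nc : N^* = N by apply/CrealP/ger0_real/ltW.
have : 0 <= dot (N *: x - d *: y) (N *: x - d *: y) by rewrite -norm_dot exprn_ge0.
rewrite dotBl !dotBr !dotZl !dotZr Nc.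
rewrite -!norm_dot -/N (dotC y x) -/d normCK.
by congr (0 <= _); ring.
Qed.

End PositiveOperators.

(** * Moments of the Bernstein polynomials *)

Section Bernstein.
Variable T : comNzRingType.
Implicit Types (x : T) (phi psi : nat -> T).

Definition bernstein x n k : T := x ^+ k * (1 - x) ^+ (n - k) *+ 'C(n, k).

(** For [x] in [0, 1] this is the expectation of [phi] under the binomial law
    of parameters [n] and [x]; the moments below are the central moments of
    that law. *)
Definition bernstein_mean x n phi : T := \sum_(k < n.+1) phi k * bernstein x n k.

Lemma bernstein_meanD x n phi psi :
  bernstein_mean x n (fun k => phi k + psi k) =
  bernstein_mean x n phi + bernstein_mean x n psi.
Proof. by rewrite -big_split; apply: eq_bigr => k _; rewrite mulrDl. Qed.

Lemma bernstein_meanZ x n c phi :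
  bernstein_mean x n (fun k => c * phi k) = c * bernstein_mean x n phi.
Proof. by rewrite big_distrr; apply: eq_bigr => k _ /=; rewrite mulrA. Qed.

Lemma eq_bernstein_mean x n phi psi :
  phi =1 psi -> bernstein_mean x n phi = bernstein_mean x n psi.
Proof. by move=> e; apply: eq_bigr => k _; rewrite e. Qed.

Lemma bernstein_mean0 x phi : bernstein_mean x 0 phi = phi 0%N.
Proof. by rewrite /bernstein_mean big_ord1 /bernstein !mulr1. Qed.

(** Conditioning on the last of [n.+1] Bernoulli trials. *)
Lemma bernstein_meanS x n phi :
  bernstein_mean x n.+1 phi =
  bernstein_mean x n (fun k => x * phi k.+1 + (1 - x) * phi k).
Proof.
rewrite /bernstein_mean big_ord_recl /=.
under eq_bigr do rewrite /bump /= add1n /bernstein binS mulrnDr mulrDr subSS.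
rewrite big_split /= addrA addrC.
under [RHS]eq_bigr do rewrite mulrDl.
rewrite big_split /=; congr (_ + _).
  by apply: eq_bigr => k _; rewrite /bernstein exprS; ring.
rewrite (eq_bigr (fun k : 'I_n.+1 => (fun j : nat => phi j *
  (x ^+ j * (1 - x) ^+ (n.+1 - j) *+ 'C(n, j))) k.+1)) => [|k _]; last first.
  by rewrite subSS.
transitivity (\sum_(k < n.+2) phi k * (x ^+ k * (1 - x) ^+ (n.+1 - k) *+ 'C(n, k))).
  rewrite [RHS]big_ord_recl; congr (_ + _).
  by rewrite /bernstein !bin0.
rewrite big_ord_recr /= bin_small// mulr0n mulr0 addr0.
apply: eq_bigr => k _; rewrite subSn; last by rewrite -ltnS.
by rewrite /bernstein exprS; ring.
Qed.

Lemma bernstein_mean_cst x n c : bernstein_mean x n (fun=> c) = c.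
Proof.
elim: n => [|n IH]; first by rewrite bernstein_mean0.
rewrite bernstein_meanS -[RHS]IH; apply: eq_bernstein_mean => k; ring.
Qed.

Lemma bernstein_moment1 x n : bernstein_mean x n (fun k => k%:R - n%:R * x) = 0.
Proof.
elim: n => [|n IH]; first by rewrite bernstein_mean0 mul0r subrr.
rewrite bernstein_meanS -[RHS]IH; apply: eq_bernstein_mean => k.
rewrite -(natr1 n) -(natr1 k); ring.
Qed.

Lemma bernstein_moment2 x n :
  bernstein_mean x n (fun k => (k%:R - n%:R * x) ^+ 2) = n%:R * (x * (1 - x)).
Proof.
elim: n => [|n IH]; first by rewrite bernstein_mean0; ring.
rewrite bernstein_meanS (@eq_bernstein_mean _ _ _ (fun k =>
  (k%:R - n%:R * x) ^+ 2 + x * (1 - x))) => [|k]; last first.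
  by rewrite -(natr1 n) -(natr1 k); ring.
by rewrite bernstein_meanD IH bernstein_mean_cst -(natr1 n); ring.
Qed.

Lemma bernstein_moment4 x n (y := x * (1 - x)) :
  bernstein_mean x n (fun k => (k%:R - n%:R * x) ^+ 4) =
  3%:R * n%:R ^+ 2 * y ^+ 2 + n%:R * y - 6%:R * n%:R * y ^+ 2.
Proof.
rewrite {}/y; elim: n => [|n IH]; first by rewrite bernstein_mean0; ring.
(* conditioning turns the fourth moment at [n.+1] into a combination of the
   moments of order 4, 2, 1 and 0 at [n]; the cubic terms cancel *)
rewrite bernstein_meanS (@eq_bernstein_mean _ _ _ (fun k =>
  (k%:R - n%:R * x) ^+ 4 + (6%:R * (x * (1 - x)) * (k%:R - n%:R * x) ^+ 2 +
  (4%:R * (x * (1 - x) ^+ 3 - (1 - x) * x ^+ 3) * (k%:R - n%:R * x) +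
   (x * (1 - x) ^+ 4 + (1 - x) * x ^+ 4))))) => [|k]; last first.
  by rewrite -(natr1 n) -(natr1 k); ring.
rewrite 3!bernstein_meanD bernstein_mean_cst !bernstein_meanZ IH.
by rewrite bernstein_moment2 bernstein_moment1 -(natr1 n); ring.
Qed.

End Bernstein.

(** * Polynomials in an operator *)

Section PolynomialCalculus.
Variables (R : realType) (V : normedModType R[i]) (A : 'B(V)).
Implicit Types (p q : {poly R}) (c : R).

(** Horner's scheme. It needs only the module structure and the composition of
    ['B(V)], which is the zero ring when [V] is trivial. *)
Definition op_poly p : 'B(V) :=
  foldr (fun c S => c%:C *: bop_id + A \ob S) 0 p.

Lemma op_poly0 : op_poly 0 = 0.
Proof. by rewrite /op_poly polyseq0. Qed.

Lemma op_poly_cons p c :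
  op_poly (p * 'X + c%:P) = c%:C *: bop_id + A \ob op_poly p.
Proof.
rewrite -cons_poly_def {1}/op_poly polyseq_cons; case: ifPn => //.
rewrite negbK nil_poly => /eqP ->; rewrite op_poly0 bop_comp0r addr0 polyseqC.
by have [->|c0] := eqVneq c 0; rewrite /= ?scale0r// bop_comp0r addr0.
Qed.

Lemma op_polyC c : op_poly c%:P = c%:C *: bop_id.
Proof. by rewrite -[c%:P]add0r -(mul0r 'X) op_poly_cons op_poly0 bop_comp0r addr0. Qed.

Lemma op_poly1 : op_poly 1 = bop_id.
Proof. by rewrite op_polyC scale1r. Qed.

Lemma op_polyX : op_poly 'X = A.
Proof.
by rewrite -['X]addr0 -[in 'X + _](mul1r 'X) op_poly_cons scale0r add0r op_poly1
  bop_comp1r.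
Qed.

Lemma op_polyD p q : op_poly (p + q) = op_poly p + op_poly q.
Proof.
elim/poly_ind: p q => [|p c IH] q; first by rewrite add0r op_poly0 add0r.
elim/poly_ind: q => [|q d _]; first by rewrite addr0 op_poly0 addr0.
rewrite addrACA -mulrDl -polyCD !op_poly_cons IH rmorphD /= scalerDl.
by rewrite bop_compDr addrACA.
Qed.

Lemma op_polyZ c p : op_poly (c *: p) = c%:C *: op_poly p.
Proof.
elim/poly_ind: p => [|p d IH]; first by rewrite scaler0 op_poly0 scaler0.
rewrite scalerDr scalerAl -[c *: d%:P]mul_polyC -polyCM !op_poly_cons IH.
by rewrite scalerDr scalerA -rmorphM /= bop_compZr.
Qed.

Lemma op_polyN p : op_poly (- p) = - op_poly p.
Proof. by rewrite -scaleN1r op_polyZ rmorphN rmorph1 scaleN1r. Qed.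

Lemma op_polyB p q : op_poly (p - q) = op_poly p - op_poly q.
Proof. by rewrite op_polyD op_polyN. Qed.

Lemma op_poly_sum (I : Type) (r : seq I) (P : pred I) (F : I -> {poly R}) :
  op_poly (\sum_(i <- r | P i) F i) = \sum_(i <- r | P i) op_poly (F i).
Proof.
by elim/big_rec2: _ => [|i a b _ <-]; rewrite ?op_poly0 ?op_polyD.
Qed.

Lemma op_polyM p q : op_poly (p * q) = op_poly p \ob op_poly q.
Proof.
elim/poly_ind: p => [|p c IH]; first by rewrite mul0r op_poly0 bop_comp0l.
rewrite mulrDl op_polyD mul_polyC op_polyZ op_poly_cons bop_compDl bop_compZl.
rewrite bop_comp1l addrC; congr (_ + _).
rewrite -bop_compA -IH mulrAC -[X in op_poly X]addr0.
by rewrite op_poly_cons scale0r add0r.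
Qed.

End PolynomialCalculus.

(** * Bernstein polynomials in a positive contraction *)

Section PositivePolynomials.
Variables (R : realType) (H : normedModType R[i]) (dot : {dot H for Num.conj}).
Hypothesis norm_dot : forall x : H, `|x| ^+ 2 = dot x x.
Variable A : 'B(H).
Hypothesis A_pos : positive_op dot A.
Hypothesis A_le1 : forall x, dot (A x) x <= dot x x.
Implicit Types (p q : {poly R}) (c : R).

Local Notation psd p := (positive_op dot (op_poly A p)).

Lemma op_poly_self_adjoint p : self_adjoint dot (op_poly A p).
Proof.
elim/poly_ind: p => [|p c IH] x y; first by rewrite op_poly0 linear0l linear0r.
rewrite op_poly_cons !bopDE dotDl dotDr !bopZE dotZl dotZr; congr (_ + _).
  by congr (_ * _); apply/esym/CrealP/complex_realP; exists c.
rewrite /= (positive_self_adjoint A_pos) IH; congr (dot x _).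
have := op_polyM A p 'X; rewrite mulrC op_polyM op_polyX.
by move=> /(congr1 (fun f : 'B(H) => f y)).
Qed.

Lemma psdD p q : psd p -> psd q -> psd (p + q).
Proof. by move=> p0 q0 x; rewrite op_polyD bopDE dotDl addr_ge0. Qed.

Lemma psd_sum n (F : 'I_n -> {poly R}) (P : pred 'I_n) :
  (forall i, P i -> psd (F i)) -> psd (\sum_(i < n | P i) F i).
Proof.
move=> F0; elim/big_rec: _ => [|i q Pi q0]; last exact: psdD (F0 i Pi) q0.
by move=> x; rewrite op_poly0 bop0E linear0l.
Qed.

Lemma psdMn p n : psd p -> psd (p *+ n).
Proof.
move=> p0; elim: n => [x|n IH]; first by rewrite mulr0n op_poly0 bop0E linear0l.
by rewrite mulrS; exact: psdD.
Qed.

Lemma psdZ c p : 0 <= c -> psd p -> psd (c *: p).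
Proof.
move=> c0 p0 x; rewrite op_polyZ bopZE dotZl mulr_ge0//.
by rewrite lecR.
Qed.

Lemma psdMn_inv p n : psd (p *+ n.+1) -> psd p.
Proof.
have n0 : 0 <= (n.+1%:R : R)^-1 by rewrite invr_ge0.
move=> /(psdZ n0); rewrite -(scaler_nat _ p) scalerA mulVf ?scale1r//.
Qed.

Lemma psd_sqrM p q : psd p -> psd (q ^+ 2 * p).
Proof.
move=> p0 x; have -> : q ^+ 2 * p = q * (p * q) by ring.
by rewrite !op_polyM /= op_poly_self_adjoint.
Qed.

Lemma psd1 : psd 1.
Proof. by move=> x; rewrite op_poly1 -norm_dot exprn_ge0. Qed.

Lemma psd_sqr q : psd (q ^+ 2).
Proof. by rewrite -[q ^+ 2]mulr1; apply/psd_sqrM/psd1. Qed.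

Lemma psdX : psd 'X.
Proof. by move=> x; rewrite op_polyX. Qed.

Lemma psd1BX : psd (1 - 'X).
Proof.
by move=> x; rewrite op_polyB op_poly1 op_polyX bopDE bopNE dotBl subr_ge0.
Qed.

(** The identity exhibits [X (1 - X)] as a sum of squares times [X] or [1 - X];
    this replaces the fact that a product of two commuting positive operators
    is positive, whose proof needs square roots. *)
Lemma psdXM1BX : psd ('X * (1 - 'X)).
Proof.
have -> : 'X * (1 - 'X) = (1 - 'X) ^+ 2 * 'X + 'X ^+ 2 * (1 - 'X) :> {poly R}.
  by ring.
apply: psdD; [exact/psd_sqrM/psdX|exact/psd_sqrM/psd1BX].
Qed.

(** Split off the square part of each of the two powers: there remains 1, [X],
    [1 - X] or [X (1 - X)]. *)
Lemma psd_bernstein n k : psd (bernstein 'X n k).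
Proof.
apply: psdMn; set m := (n - k)%N.
have half_sqr (q : {poly R}) j : q ^+ j = (q ^+ j./2) ^+ 2 * q ^+ odd j.
  by rewrite -exprM -exprD muln2 addnC odd_double_half.
rewrite (half_sqr 'X) (half_sqr (1 - 'X)) mulrACA -exprMn; apply: psd_sqrM.
case: (odd k); case: (odd m); rewrite ?expr1 ?expr0 ?mulr1 ?mul1r.
- exact: psdXM1BX.
- exact: psdX.
- exact: psd1BX.
- exact: psd1.
Qed.

(** From [0 <= p <= c] follows [p ^+ 2 <= c ^+ 2], because the two cross terms
    [(c - p) p (c - p)] and [p (c - p) p] are positive; and [p] is self-adjoint,
    so the form of [p ^+ 2] is the squared norm of the value of [p]. *)
Lemma psd_norm_le p c : 0 < c -> psd p -> psd (c%:P - p) ->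
  forall x, rnorm (op_poly A p x) <= c * rnorm x.
Proof.
move=> c0 p0 cp x.
have c1 : 0 <= c^-1 by rewrite invr_ge0 ltW.
have : psd ((c ^+ 2)%:P - p ^+ 2).
  have -> : (c ^+ 2)%:P - p ^+ 2 = c *: (c%:P - p) +
      c^-1 *: ((c%:P - p) ^+ 2 * p + p ^+ 2 * (c%:P - p)).
    have -> : (c%:P - p) ^+ 2 * p + p ^+ 2 * (c%:P - p) = c%:P * (p * (c%:P - p)).
      by ring.
    rewrite mul_polyC scalerA mulVf ?gt_eqF// scale1r -mul_polyC polyC_exp.
    by ring.
  apply: psdD; first exact: psdZ (ltW c0) cp.
  by apply: psdZ => //; apply: psdD; exact: psd_sqrM.
move=> /(_ x); rewrite op_polyB op_polyC bopDE bopNE dotBl bopZE dotZl -norm_dot.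
rewrite (expr2 p) op_polyM /= op_poly_self_adjoint -norm_dot subr_ge0.
rewrite !rnormE -!rmorphXn -rmorphM lecR -exprMn.
by rewrite ler_pXn2r// ?nnegrE ?mulr_ge0 ?rnorm_ge0// ltW.
Qed.

(** On [0, 1] the fourth central moment is at most [n ^ 2]; as [X] is replaced by
    an operator, the bound needs a certificate. With [y = X (1 - X)], sixteen
    times the difference is a combination with nonnegative coefficients of 1,
    of squares, and of [1 - 16 y ^ 2 = (1 - 2 X) ^ 2 (1 + 4 y)]. *)
Lemma psd_moment4 n : (0 < n)%N ->
  psd (n%:R ^+ 2 - bernstein_mean 'X n (fun k => (k%:R - n%:R * 'X) ^+ 4)).
Proof.
have psdMl m p : psd p -> psd (m%:R * p) by rewrite mulr_natl; exact: psdMn.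
case: n => // n _; rewrite bernstein_moment4; apply: (@psdMn_inv _ 15%N).
rewrite -mulr_natl; move: psdXM1BX; set X : {poly R} := 'X => psdy.
set y := X * (1 - X) in psdy *.
set q := (X in psd X); have -> : q =
    n.+1%:R * (n.+1%:R * (3%:R * ((1 - 2%:R * X) ^+ 2 * (1 + 4%:R * y)))) +
    (n.+1%:R * (4%:R * (1 - 2%:R * X) ^+ 2) +
    (n.+1%:R * (96%:R * y ^+ 2) + n.+1%:R * (n%:R * 13%:R + 9%:R * 1))).
  by rewrite /q /y -(natr1 n); ring.
repeat apply: psdD; apply: (psdMl n.+1).
- by do 2!apply: (psdMl _ _); apply/psd_sqrM/psdD; [exact: psd1|exact: psdMl].
- exact/psdMl/psd_sqr.
- exact/psdMl/psd_sqr.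
- apply: psdD; last exact/psdMl/psd1.
  by rewrite -[13%:R]mulr1; do 2!apply: (psdMl _ _); exact: psd1.
Qed.

(** Each summand of the fourth moment is positive, hence bounded by the whole
    moment. The fourth power is what makes the bound useful: the [n + 1] bounds
    of order [n ^ -2] add up to something that tends to 0. *)
Lemma bernstein_localised n k x : (0 < n)%N -> (k <= n)%N ->
  rnorm (op_poly A (('X - (k%:R / n%:R)%:P) ^+ 4 * bernstein 'X n k) x)
    <= (n%:R ^+ 2)^-1 * rnorm x.
Proof.
move=> n0 kn; have n0' : n%:R != 0 :> R by rewrite pnatr_eq0 -lt0n.
have n4 : (0 : R) <= (n%:R ^+ 4)^-1 by rewrite invr_ge0 exprn_ge0.
pose q j : {poly R} := ('X - (j%:R / n%:R)%:P) ^+ 4 * bernstein 'X n j.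
have qE j : q j = (n%:R ^+ 4)^-1 *: ((j%:R - n%:R * 'X) ^+ 4 * bernstein 'X n j).
  rewrite /q scalerAl; congr (_ * _).
  have -> : 'X - (j%:R / n%:R)%:P = - (n%:R^-1 *: (j%:R - n%:R * 'X)) :> {poly R}.
    rewrite scalerBr opprB -!polyC_natr mul_polyC scalerA mulVf// scale1r.
    by congr (_ - _); rewrite -mul_polyC -polyCM mulrC.
  by rewrite exprNn -signr_odd mul1r exprZn exprVn.
have q0 j : psd (q j).
  rewrite /q (_ : ('X - _) ^+ 4 = (('X - (j%:R / n%:R)%:P) ^+ 2) ^+ 2).
    exact/psd_sqrM/psd_bernstein.
  by rewrite -exprM.
apply: psd_norm_le; [by rewrite invr_gt0 exprn_gt0// ltr0n|exact: q0|].
have -> : ((n%:R ^+ 2)^-1)%:P = (n%:R ^+ 4)^-1 *: (n%:R ^+ 2) :> {poly R}.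
  rewrite -polyC_natr -polyC_exp -mul_polyC -polyCM; congr (_%:P).
  by field.
rewrite -(subrK (bernstein_mean 'X n (fun k => (k%:R - n%:R * 'X) ^+ 4)) (n%:R ^+ 2)).
rewrite scalerDr -addrA; apply: psdD.
  by apply: psdZ => //; exact: psd_moment4.
rewrite scaler_sumr (eq_bigr (fun j : 'I_n.+1 => q j)) => [|j _]; last by rewrite qE.
have kS : (k < n.+1)%N by [].
rewrite (bigD1 (Ordinal kS)) //= -/(q k) addrAC subrr add0r.
by apply: psd_sum => j _; exact: q0.
Qed.

End PositivePolynomials.

(** * Localisation along a positive operator *)

Definition is_seminorm (R : realType) (V : normedModType R[i]) (p : V -> R) :=
  (forall x y, p (x + y) <= p x + p y) /\
  (forall (r : R) x, p (r%:C *: x) <= `|r| * p x).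

(** Continuity of left multiplication by [A] for the seminorm [p]. For
    [p X = rnorm (T X)] it holds as soon as [T] commutes with that
    multiplication. *)
Definition left_tame (R : realType) (V : normedModType R[i]) (A : 'B(V))
    (p : 'B(V) -> R) :=
  exists2 K : R, 0 <= K & forall X, p (A \ob X) <= K * p X.

Section Localisation.
Variables (R : realType) (H : normedModType R[i]) (dot : {dot H for Num.conj}).
Hypothesis norm_dot : forall x : H, `|x| ^+ 2 = dot x x.
Variable p : 'B(H) -> R.
Hypothesis p_sn : is_seminorm p.

Lemma seminorm_ge0 X : 0 <= p X.
Proof.
have [pD pZ] := p_sn.
have := pZ 0 X; rewrite scale0r normr0 mul0r => p0.
have p00 : 0 <= p 0 by have := pD 0 0; rewrite addr0 lerDl.
have := pD X (- X); rewrite subrr => pXX.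
have := pZ (-1) X; rewrite rmorphN rmorph1 scaleN1r normrN1 mul1r => pN.
lra.
Qed.

Lemma left_tame_op_poly A q : left_tame A p -> left_tame (op_poly A q) p.
Proof.
have [pD pZ] := p_sn; move=> [K K0 pK].
elim/poly_ind: q => [|q c [L L0 pL]].
  exists 0 => // X; rewrite op_poly0 bop_comp0l mul0r -(scale0r (0 : 'B(H))).
  by rewrite (le_trans (pZ 0 _))// normr0 mul0r.
exists (`|c| + K * L) => [|X]; first by rewrite addr_ge0 ?mulr_ge0.
rewrite op_poly_cons bop_compDl bop_compZl bop_comp1l -bop_compA.
rewrite (le_trans (pD _ _))// mulrDl lerD// (le_trans (pK _))// -mulrA.
by rewrite ler_wpM2l.
Qed.

(** Apply the lower bound to [X], [(A - t) X], [(A - t)^2 X] and so on: each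
    step costs a multiple of [p X], with a factor that depends on [r] but not
    on [t]. *)
Lemma iterated_lower_bound A (c : R) : 0 < c -> left_tame A p ->
  (forall t, 0 <= t <= 1 -> forall X : 'B(H),
     c * rnorm X <= rnorm (A \ob X - t%:C *: X) + p X) ->
  forall r, exists2 L : R, 0 <= L & forall t, 0 <= t <= 1 -> forall X : 'B(H),
    c ^+ r * rnorm X <= rnorm (op_poly A (('X - t%:P) ^+ r) \ob X) + L * p X.
Proof.
have [pD pZ] := p_sn; move=> c0 [K K0 pK] hc; elim=> [|r [L L0 hL]].
  exists 0 => // t _ X; rewrite !expr0 op_poly1 bop_comp1l mul1r mul0r addr0.
  exact: lexx.
exists (L * (K + 1) + c ^+ r) => [|t t01 X].
  by rewrite addr_ge0 ?exprn_ge0 ?(ltW c0)// mulr_ge0// addr_ge0.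
pose Y := op_poly A ('X - t%:P) \ob X.
have YE : Y = A \ob X - t%:C *: X.
  by rewrite /Y op_polyB op_polyX op_polyC bop_compBl bop_compZl bop_comp1l.
have pY : p Y <= (K + 1) * p X.
  rewrite YE -scaleNr -rmorphN /=.
  rewrite (le_trans (pD _ _))// mulrDl lerD// (le_trans (pZ _ _))// mul1r.
  rewrite normrN ler_piMl ?seminorm_ge0//.
  by case/andP: t01 => t0 t1; rewrite ger0_norm.
rewrite exprSr -mulrA (@le_trans _ _ (c ^+ r * (rnorm Y + p X)))//.
  apply: ler_wpM2l; first by rewrite exprn_ge0// ltW.
  by rewrite YE; exact: hc.
rewrite mulrDr (le_trans (lerD (hL _ t01 Y) (lexx _)))//.
rewrite exprSr op_polyM -bop_compA mulrDl addrA lerD2r lerD2l.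
by rewrite -mulrA ler_wpM2l.
Qed.

(** Were [p] not bounded below, there would be unit vectors on which [p] tends to
    0, and, among the vectors that [A] makes of them, an approximate eigenvector
    of [A]. Quantitatively: with the uniform constant [c] and the Bernstein
    partition of unity [\sum_k b_k(A) = 1], four applications of the local bound
    at [t = k / n] to [b_k(A) X] give
    [c^4 |b_k(A) X| <= |(A - k/n)^4 b_k(A) X| + O(p X) <= n^-2 |X| + O(p X)], and
    the sum over [k] yields [c^4 |X| <= (n + 1) n^-2 |X| + O(p X)]. For large [n]
    the first term is absorbed in the left-hand side. *)
Lemma bounded_below_of_local_contraction A : positive_op dot A ->
  (forall x, dot (A x) x <= dot x x) -> left_tame A p ->
  (forall t : R, 0 <= t <= 1 ->
    bounded_below (fun X : 'B(H) => rnorm (A \ob X - t%:C *: X) + p X)) ->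
  bounded_below p.
Proof.
move=> A0 A1 Ap hA.
have [|c c0 hc] := @uniformly_bounded_below R 'B(H)
    (fun t X => rnorm (A \ob X - t%:C *: X) + p X) 1 0 1 ler01 _ hA.
  move=> s t X; rewrite addrAC lerD2r mul1r.
  have -> : A \ob X - s%:C *: X = (A \ob X - t%:C *: X) - (s - t)%:C *: X.
    by rewrite rmorphB scalerBl opprB addrA subrK.
  rewrite (le_trans (rnormB _ _))// lerD2l rnormZ normc_def /= expr0n addr0.
  by rewrite sqrtr_sqr.
have [L L0 hL] := iterated_lower_bound c0 Ap hc 4.
have c4 : 0 < c ^+ 4 by rewrite exprn_gt0.
(* [(n + 1) / n ^ 2 <= 2 / n <= c ^ 4 / 2] *)
have [n n0 hn] : exists2 n : nat, (0 < n)%N & 4 / c ^+ 4 <= n%:R.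
  have h4 : 0 <= 4 / c ^+ 4 by rewrite divr_ge0// ltW.
  exists (Num.bound (4 / c ^+ 4)); last exact/ltW/archi_boundP.
  by rewrite -(ltr_nat R) (le_lt_trans h4)//; exact: archi_boundP.
have nR : 0 < n%:R :> R by rewrite ltr0n.
have [K hK0 hK] : exists2 K : nat -> R, (forall k, 0 <= K k) &
    forall k X, p (op_poly A (bernstein 'X n k) \ob X) <= K k * p X.
  have /choice[K hK] : forall k, exists K : R,
      0 <= K /\ forall X, p (op_poly A (bernstein 'X n k) \ob X) <= K * p X.
    by move=> k; have [K K0 hK] := left_tame_op_poly (bernstein 'X n k) Ap; exists K.
  by exists K => k; have [] := hK k.
pose M := L * \sum_(k < n.+1) K k.
have M0 : 0 <= M by rewrite mulr_ge0// sumr_ge0.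
exists (c ^+ 4 / 2 / (M + 1)).
  by rewrite !divr_gt0// ltr_pwDr.
move=> X; rewrite mulrAC ler_pdivrMr ?ltr_pwDr// (mulrC (p X)).
have XE : X = \sum_(k < n.+1) (op_poly A (bernstein 'X n k) \ob X).
  rewrite -bop_comp_suml -op_poly_sum.
  have <- : bernstein_mean 'X n (fun=> 1) =
      \sum_(k < n.+1) bernstein 'X n k :> {poly R}.
    by rewrite /bernstein_mean; apply: eq_bigr => k _; rewrite mul1r.
  by rewrite bernstein_mean_cst op_poly1 bop_comp1l.
have hX : c ^+ 4 * rnorm X <= (c ^+ 4 / 2) * rnorm X + M * p X.
  rewrite {1}XE (le_trans (ler_wpM2l (ltW c4) (rnorm_sum _ _ _)))// mulr_sumr.
  have bk (k : 'I_n.+1) : c ^+ 4 * rnorm (op_poly A (bernstein 'X n k) \ob X) <=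
      (n%:R ^+ 2)^-1 * rnorm X + L * K k * p X.
    have k01 : 0 <= (k%:R / n%:R : R) <= 1.
      by rewrite divr_ge0//= ler_pdivrMr// mul1r ler_nat -ltnS.
    rewrite (le_trans (hL _ k01 _))// lerD//; last by rewrite -mulrA ler_wpM2l.
    rewrite bop_compA -op_polyM bop_rnormE (le_trans (opnorm_comp _ _))//.
    rewrite ler_wpM2r ?opnorm_ge0//; apply: opnorm_le => [|x].
      by rewrite invr_ge0 exprn_ge0.
    by apply: (bernstein_localised norm_dot) => //; rewrite -ltnS.
  rewrite (le_trans (ler_sum _ (fun k _ => bk k)))// big_split /=.
  rewrite sumr_const card_ord -mulr_suml -mulr_sumr lerD2r -[leLHS]mulr_natl mulrA.
  rewrite ler_wpM2r ?rnorm_ge0// ler_pdivrMr ?exprn_gt0//.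
  move: hn; rewrite ler_pdivrMr// => hn.
  have n1 : 1 <= n%:R :> R by rewrite ler1n.
  rewrite -natr1 expr2; nra.
have := seminorm_ge0 X; lra.
Qed.

(** Reduction to a contraction, dividing [A] by [opnorm A + 1]. *)
Lemma bounded_below_of_local A : positive_op dot A -> left_tame A p ->
  (forall t : R, 0 <= t ->
    bounded_below (fun X : 'B(H) => rnorm (A \ob X - t%:C *: X) + p X)) ->
  bounded_below p.
Proof.
move=> A0 [K K0 pK] hA; pose M := opnorm A + 1.
have M0 : 0 < M by rewrite ltr_pwDr ?opnorm_ge0.
have Mi : 0 <= M^-1 by rewrite invr_ge0 ltW.
have [pD pZ] := p_sn.
apply: (@bounded_below_of_local_contraction ((M^-1)%:C *: A)).
- by move=> x; rewrite bopZE dotZl mulr_ge0// lecR.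
- move=> x; rewrite bopZE dotZl -norm_dot -(ger0_norm (A0 x)).
  have AM : `|dot (A x) x| <= M%:C * `|x| ^+ 2.
    rewrite (le_trans (dot_cauchy_schwarz norm_dot _ _))// expr2 mulrA.
    rewrite ler_wpM2r// !rnormE -rmorphM lecR (le_trans (opnormP _ _))//.
    by rewrite ler_wpM2r ?rnorm_ge0// lerDl.
  rewrite (le_trans (ler_wpM2l _ AM)) ?lecR// mulrA -rmorphM /= mulVf ?gt_eqF//.
  by rewrite mul1r.
- exists (M^-1 * K) => [|X]; first by rewrite mulr_ge0.
  rewrite bop_compZl (le_trans (pZ _ _))// ger0_norm// -mulrA ler_wpM2l//.
- move=> t /andP[t0 t1]; have [|c c0 hc] := hA (M * t); first by rewrite mulr_ge0// ltW.
  exists (c / (M + 1)); first by rewrite divr_gt0// ltr_pwDr// ltW.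
  move=> X; rewrite mulrAC ler_pdivrMr; last by rewrite ltr_pwDr// ltW.
  rewrite (le_trans (hc X))//.
  have -> : A \ob X - (M * t)%:C *: X =
      M%:C *: ((M^-1)%:C *: A \ob X - t%:C *: X).
    rewrite bop_compZl scalerBr !scalerA -!rmorphM /= divff ?gt_eqF//.
    by rewrite scale1r.
  rewrite rnormZr; last exact: ltW.
  set Z := rnorm _; have Z0 : 0 <= Z by exact: rnorm_ge0.
  have := mulr_ge0 (ltW M0) (seminorm_ge0 X).
  by move: (p X) => q Mq0; nra.
Qed.

End Localisation.

Section JointLocalisation.
Variables (R : realType) (H : normedModType R[i]) (dot : {dot H for Num.conj}).
Hypothesis norm_dot : forall x : H, `|x| ^+ 2 = dot x x.
Variable A : nat -> 'B(H).
Hypothesis A_pos : forall i, positive_op dot (A i).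
Hypothesis A_comm : forall i j, A i \ob A j = A j \ob A i.

(** The operators are removed one at a time. Commutativity keeps the induction
    going: it makes the seminorm [X |-> rnorm (A i X - t i X)] tame with respect
    to left multiplication by all the other operators. *)
Lemma bounded_below_of_joint n (p : 'B(H) -> R) :
  is_seminorm p -> (forall j, left_tame (A j) p) ->
  (forall t : nat -> R, (forall i, 0 <= t i) -> bounded_below (fun X : 'B(H) =>
     p X + \sum_(i < n) rnorm (A i \ob X - (t i)%:C *: X))) ->
  bounded_below p.
Proof.
elim: n p => [|n IH] p p_sn pA hp.
  have [|c c0 hc] := hp (fun=> 0); first by [].
  by exists c => // X; have := hc X; rewrite big_ord0 addr0.
apply: (bounded_below_of_local norm_dot p_sn (A_pos n) (pA n)) => s s0.
have [pD pZ] := p_sn; apply: IH.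
- split=> [X Y|r X].
    have -> : A n \ob (X + Y) - s%:C *: (X + Y) =
        (A n \ob X - s%:C *: X) + (A n \ob Y - s%:C *: Y).
      by rewrite bop_compDr scalerDr opprD addrACA.
    by rewrite [leRHS]addrACA lerD ?rnormD ?pD.
  have -> : A n \ob (r%:C *: X) - s%:C *: (r%:C *: X) =
      r%:C *: (A n \ob X - s%:C *: X).
    by rewrite bop_compZr scalerBr !scalerA mulrC.
  rewrite mulrDr lerD//.
  by rewrite rnormZ normc_def /= expr0n addr0 sqrtr_sqr.
- move=> j; have [K K0 pK] := pA j.
  exists (K + opnorm (A j)) => [|X]; first by rewrite addr_ge0 ?opnorm_ge0.
  rewrite bop_compA A_comm -bop_compA -bop_compZr -bop_compBr.
  set Z := A n \ob X - s%:C *: X.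
  have := opnorm_comp (A j) Z; rewrite -!bop_rnormE => AZ.
  have Z0 := rnorm_ge0 Z; have A0 := rnorm_ge0 (A j).
  have X0 := seminorm_ge0 p_sn X; have := pK X; move: AZ; nra.
- move=> t t0; pose t' i := if i == n then s else t i.
  have [|c c0 hc] := hp t'; first by move=> i; rewrite /t'; case: ifP.
  exists c => // X; rewrite (le_trans (hc X))// big_ord_recr /= /t' eqxx.
  rewrite (eq_bigr (fun i : 'I_n => rnorm (A i \ob X - (t i)%:C *: X))) => [|i _].
    by rewrite [in leRHS](addrC _ (p X)) -[leRHS]addrA lerD2l addrC.
  by rewrite ltn_eqF.
Qed.

End JointLocalisation.

(** * Spectra contained in the half-line *)

Section HalfLine.
Variable R : realType.

Lemma half_line_gap (l : R[i]) : ~~ (0 <= l) ->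
  exists2 d : R, 0 < d & forall z : R[i], 0 <= z -> d%:C <= `|z - l|.
Proof.
case: l => a b; rewrite lecE /= negb_and => l0.
have [b0|b0] := eqVneq b 0; last first.
  exists `|b|; first by rewrite normr_gt0.
  case=> x y z0; rewrite normc_def lecR -sqrtr_sqr ler_wsqrtr//=.
  by rewrite (ger0_Im z0 : y = 0) sub0r sqrrN lerDr sqr_ge0.
exists (- a); first by move: l0; rewrite b0 eqxx /= -ltNge oppr_gt0.
case=> x y z0; rewrite normc_def lecR b0 /= (ger0_Im z0 : y = 0) subrr expr0n addr0.
rewrite sqrtr_sqr (le_trans _ (ler_norm _))// lerDr.
by move: z0; rewrite lecE => /andP[].
Qed.

(** Being bounded below off the half-line is enough: the ray from [l] to infinity
    avoids the half-line, so that [u T - l = u (T - l / u)] is bounded below for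
    all [u] in [0, 1], and the method of continuity applies. *)
Lemma spectrum_sub_half_line (E : completeNormedModType R[i]) (T : 'B(E)) :
  (forall l, ~~ (0 <= l) -> bounded_below (fun x => rnorm (T x - l *: x))) ->
  spectrum T `<=` [set r%:C | r in `[0 : R, +oo[ ].
Proof.
move=> hT l Tl; have [l0|l0] := boolP (0 <= l).
  exists (complex.Re l); last by apply/RRe_real/ger0_real.
  by move: l0; rewrite /= in_itv /= andbT lecE /= => /andP[].
exfalso; apply: Tl; have [c c0 hc] := hT l l0.
have Ts y : exists x, T x - l *: x = y.
  apply: surjective_continuation => u /andP[u0 u1].
  have [->|un0] := eqVneq u 0.
    exists (complex.Re `|l|) => [|x].
      rewrite -ltcR; have -> : (complex.Re `|l|)%:C = `|l| by rewrite normc_def.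
      by rewrite normr_gt0; apply: contraNneq l0 => ->.
    by rewrite scale0r sub0r rnormN rnormZ.
  have up : 0 < u by rewrite lt_neqAle eq_sym un0.
  have ul : ~~ (0 <= (u^-1)%:C * l).
    by rewrite pmulr_rge0// ltcR invr_gt0.
  have [k k0 hk] := hT _ ul; exists (u * k) => [|x]; first exact: mulr_gt0.
  have -> : u%:C *: T x - l *: x = u%:C *: (T x - ((u^-1)%:C * l) *: x).
    by rewrite scalerBr scalerA mulrA -rmorphM /= divff// mul1r.
  by rewrite rnormZr// -mulrA ler_wpM2l.
have [S [TS ST _]] := @bop_inverse R E (T - l *: bop_id) c c0 hc Ts.
by exists S.
Qed.

(** The lower bound comes from the numerical range: [<C x, x> / <x, x>] is
    nonnegative, hence at distance at least [d] from [l]. It also holds for all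
    [u C] with [u >= 0], so the method of continuity gives surjectivity. *)
Lemma positive_resolvent (H : completeNormedModType R[i])
    (dot : {dot H for Num.conj}) (norm_dot : forall x : H, `|x| ^+ 2 = dot x x)
    (C : 'B(H)) (l : R[i]) (d : R) :
  positive_op dot C -> 0 < d -> (forall z : R[i], 0 <= z -> d%:C <= `|z - l|) ->
  exists2 S : 'B(H), (C - l *: bop_id) \ob S = bop_id & d * opnorm S <= 1.
Proof.
move=> C0 d0 dl.
have lower (T : 'B(H)) : positive_op dot T ->
    forall x, d * rnorm x <= rnorm (T x - l *: x).
  move=> T0 x; have [->|x0] := eqVneq x 0; first by rewrite rnorm0 mulr0 rnorm_ge0.
  have n0 : 0 < `|x| by rewrite normr_gt0.
  rewrite -lecR rmorphM /= -!rnormE -(ler_pM2r n0).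
  rewrite (le_trans _ (dot_cauchy_schwarz norm_dot _ _))// dotBl dotZl -norm_dot.
  have -> : dot (T x) x - l * `|x| ^+ 2 =
      (dot (T x) x / `|x| ^+ 2 - l) * `|x| ^+ 2.
    by rewrite mulrBl divfK// expf_neq0// gt_eqF.
  rewrite normrM normrX normr_id -mulrA -expr2 ler_wpM2r ?exprn_ge0//.
  by apply: dl; rewrite divr_ge0// exprn_ge0.
have [|S [TS _ hS]] := @bop_inverse R H (C - l *: bop_id) d d0 (lower C C0).
  apply: surjective_continuation => u /andP[u0 _]; exists d => // x.
  apply: (lower (u%:C *: C)) => y.
  by rewrite bopZE dotZl mulr_ge0// lecR.
exists S => //; rewrite mulrC -ler_pdivlMr// div1r; apply: opnorm_le.
  by rewrite invr_ge0 ltW.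
by move=> x; rewrite ler_pdivlMl.
Qed.

End HalfLine.

(** * The elementary operator *)

Section ElementaryOperator.
Variables (R : realType) (H : completeNormedModType R[i]).
Variable dot : {dot H for Num.conj}.
Hypothesis norm_dot : forall x : H, `|x| ^+ 2 = dot x x.
Variable A : nat -> 'B(H).
Hypothesis A_pos : forall i, positive_op dot (A i).
Hypothesis A_comm : forall i j, A i \ob A j = A j \ob A i.

Variable B : nat -> 'B(H).
Hypothesis B_pos : forall i, positive_op dot (B i).
Hypothesis A_sum : cvgn (series (fun i => opnorm (A i) ^+ 2)).
Hypothesis B_sum : cvgn (series (fun i => opnorm (B i) ^+ 2)).
Variable Delta : 'B('B(H)).
Hypothesis DeltaE : is_elementary_op A B Delta.

Lemma elementary_op_tail (e : R) : 0 < e -> exists N, forall X : 'B(H),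
  rnorm (Delta X - \sum_(i < N) A i \ob X \ob B i) <= e * rnorm X.
Proof.
move=> e0; pose c i : R := opnorm (A i) ^+ 2 + opnorm (B i) ^+ 2.
have cc : cvgn (series c) by exact: is_cvg_seriesD A_sum B_sum.
have tm i (X : 'B(H)) : rnorm (A i \ob X \ob B i) <= c i * rnorm X.
  rewrite bop_rnormE (le_trans (opnorm_comp _ _))//.
  have := opnorm_comp (A i) X; rewrite -!bop_rnormE /c -!bop_rnormE.
  have := rnorm_ge0 (A i); have := rnorm_ge0 (B i); have := rnorm_ge0 X.
  move: (rnorm (A i \ob X)) (rnorm (A i)) (rnorm (B i)) (rnorm X).
  move=> ax a b x x0 b0 a0 axE; apply: (@le_trans _ _ (a * x * b)).
    by rewrite ler_wpM2r.
  by rewrite mulrAC ler_wpM2r//; nra.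
have /cauchy_cvgP/cauchy_seriesP/(_ _ e0) := cc.
case=> -[P Q] [[N1 _ hN1] [N2 _ hN2]] h; pose N := maxn N1 N2.
have cN n : (N <= n)%N -> \sum_(N <= i < n) c i < e.
  move=> Nn; apply: le_lt_trans (h (N, n) _); first exact: ler_norm.
  split; first by apply: hN1; exact: leq_maxl.
  by apply: hN2 => /=; rewrite (leq_trans _ Nn)// leq_maxr.
exists N => X; apply/ler_addgt0Pl => d d0.
have [M _ /(_ (maxn M N) (leq_maxl _ _))] := cvg_rnorm (@DeltaE X) d0.
set n := maxn M N => /= Dn; have Nn : (N <= n)%N by exact: leq_maxr.
have SE : series (fun i => A i \ob X \ob B i) n - \sum_(i < N) A i \ob X \ob B i =
    \sum_(N <= i < n) A i \ob X \ob B i.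
  rewrite /series /= (@big_cat_nat _ _ _ N)//= big_mkord [X in X - _]addrC.
  exact: addrK.
rewrite -(subrK (series (fun i => A i \ob X \ob B i) n) (Delta X)) -addrA SE.
rewrite (le_trans (rnormD _ _))// lerD//; first exact: ltW.
rewrite (le_trans (rnorm_sum _ _ _))//.
rewrite (le_trans (ler_sum _ (fun i _ => tm i X)))// -mulr_suml.
by rewrite ler_wpM2r ?rnorm_ge0// ltW// cN.
Qed.

(** The only place where the commutation of the [A i] meets the series: left
    multiplication by [A j] passes through every partial sum. *)
Lemma elementary_op_comm j X : Delta (A j \ob X) = A j \ob Delta X.
Proof.
apply/eqP; rewrite -subr_eq0; apply/eqP/rnorm_eq0/le_anti.
rewrite rnorm_ge0 andbT; apply/ler_addgt0Pl => e e0; rewrite addr0.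
have K0 : 0 < 2 * opnorm (A j) * rnorm X + 1.
  by rewrite ltr_pwDr// !mulr_ge0 ?opnorm_ge0 ?rnorm_ge0.
have [N hN] := elementary_op_tail (divr_gt0 e0 K0).
set S := fun Y : 'B(H) => \sum_(i < N) A i \ob Y \ob B i in hN.
have SA : S (A j \ob X) = A j \ob S X.
  rewrite /S bop_comp_sumr; apply: eq_bigr => i _.
  by rewrite !bop_compA A_comm.
have -> : Delta (A j \ob X) - A j \ob Delta X =
    (Delta (A j \ob X) - S (A j \ob X)) - A j \ob (Delta X - S X).
  by rewrite bop_compBr SA opprB addrA subrK.
rewrite (le_trans (rnormB _ _))// (le_trans (lerD (hN _) (opnorm_comp _ _)))//.
have := opnorm_comp (A j) X; have := hN X; rewrite -!bop_rnormE.
have := opnorm_ge0 (A j); have := rnorm_ge0 X.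
set f := e / _; have f0 : 0 <= f by rewrite divr_ge0// ltW.
have : f * (2 * opnorm (A j) * rnorm X + 1) = e by rewrite divfK// gt_eqF.
rewrite -!bop_rnormE; move: f f0 (rnorm (Delta X - S X)) (rnorm (A j \ob X)).
move: (rnorm (A j)) (rnorm X) => a x f f0 y z <- x0 a0 yx zax.
have := ler_wpM2l f0 zax; have := ler_wpM2l a0 yx; lra.
Qed.

(** Where [A i X] is close to [t i X], [Delta X - l X] is close to
    [X (C - l)] with [C = \sum_i (t i) (B i)] a positive operator, and the norm of
    [X (C - l)] is at least [d] times that of [X]. The tail of the series spends
    half of this lower bound. *)
Lemma local_lower_bound (l : R[i]) (d : R) N (t : nat -> R) : 0 < d ->
  (forall z : R[i], 0 <= z -> d%:C <= `|z - l|) ->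
  (forall X : 'B(H),
    rnorm (Delta X - \sum_(i < N) A i \ob X \ob B i) <= d / 2 * rnorm X) ->
  (forall i, 0 <= t i) ->
  bounded_below (fun X : 'B(H) => rnorm (Delta X - l *: X) +
    \sum_(i < N) rnorm (A i \ob X - (t i)%:C *: X)).
Proof.
move=> d0 dl tail t0; pose C := \sum_(i < N) (t i)%:C *: B i.
have C0 : positive_op dot C.
  move=> x; rewrite /C; elim/big_rec: _ => [|i D _ D0].
    by rewrite bop0E linear0l.
  rewrite bopDE bopZE dotDl dotZl addr_ge0// mulr_ge0 ?lecR//; exact: B_pos.
have [S CS dS] := positive_resolvent norm_dot C0 d0 dl.
have lower (X : 'B(H)) : d * rnorm X <= rnorm (X \ob (C - l *: bop_id)).
  have XE : X = (X \ob (C - l *: bop_id)) \ob S.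
    by rewrite -bop_compA CS bop_comp1r.
  rewrite {1}XE bop_rnormE (le_trans (ler_wpM2l (ltW d0) (opnorm_comp _ _)))//.
  by rewrite mulrCA ler_piMr ?opnorm_ge0.
pose K := 1 + \sum_(i < N) opnorm (B i).
have K1 : 1 <= K by rewrite lerDl sumr_ge0// => i _; exact: opnorm_ge0.
have BK (i : 'I_N) : opnorm (B i) <= K.
  rewrite /K (bigD1 i) //= addrCA lerDl addr_ge0// sumr_ge0// => j _.
  exact: opnorm_ge0.
have K0 : 0 < K by exact: lt_le_trans K1.
exists (d / 2 / K) => [|X]; first by rewrite !divr_gt0.
rewrite mulrAC ler_pdivrMr// mulrDl mulr_suml.
have E : X \ob (C - l *: bop_id) = (Delta X - l *: X) -
    (Delta X - \sum_(i < N) A i \ob X \ob B i) -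
    \sum_(i < N) (A i \ob X - (t i)%:C *: X) \ob B i.
  rewrite bop_compBr bop_compZr bop_comp1r bop_comp_sumr.
  under [X in _ = _ - X]eq_bigr do rewrite bop_compBl bop_compZl.
  rewrite sumrB; under eq_bigr do rewrite bop_compZr.
  set u := \sum_(i < N) _; set v := \sum_(i < N) _.
  by rewrite !opprB [RHS]addrC [X in _ = _ + X]addrC !addrA !subrK.
have h : d * rnorm X <= rnorm (Delta X - l *: X) + d / 2 * rnorm X +
    \sum_(i < N) rnorm (A i \ob X - (t i)%:C *: X) * K.
  rewrite (le_trans (lower X))// E (le_trans (rnormB _ _))// lerD//.
    by rewrite (le_trans (rnormB _ _))// lerD2l.
  rewrite (le_trans (rnorm_sum _ _ _))// ler_sum// => i _.
  rewrite bop_rnormE (le_trans (opnorm_comp _ _))// -bop_rnormE.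
  by rewrite ler_wpM2l ?rnorm_ge0.
have p0 := rnorm_ge0 (Delta X - l *: X).
have := ler_peMr p0 K1; lra.
Qed.

End ElementaryOperator.

Theorem corollary4p3 (R : realType) (H : completeNormedModType R[i])
    (dot : {dot H for Num.conj})
    (norm_dot : forall x : H, `|x| ^+ 2 = dot x x)
    (A B : nat -> 'B(H))
    (A_pos : forall i, positive_op dot (A i))
    (B_pos : forall i, positive_op dot (B i))
    (A_sum : cvgn (series (fun i => opnorm (A i) ^+ 2)))
    (B_sum : cvgn (series (fun i => opnorm (B i) ^+ 2)))
    (Delta : 'B('B(H)))
    (DeltaE : is_elementary_op A B Delta)
    (A_comm : forall i j, A i \ob A j = A j \ob A i) :
  spectrum Delta `<=` [set r%:C | r in `[0 : R, +oo[ ].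
Proof.
apply: spectrum_sub_half_line => l /half_line_gap[d d0 dl].
have [N tail] := elementary_op_tail A_sum B_sum DeltaE (divr_gt0 d0 (ltr0n R 2)).
apply: (bounded_below_of_joint norm_dot A_pos A_comm (n := N)).
- split=> [X Y|r X].
    rewrite linearD scalerDr opprD addrACA; exact: rnormD.
  rewrite linearZ scalerA mulrC -scalerA -scalerBr.
  by rewrite rnormZ normc_def /= expr0n addr0 sqrtr_sqr.
- move=> j; exists (opnorm (A j)) => [|X]; first exact: opnorm_ge0.
  rewrite (elementary_op_comm A_comm A_sum B_sum DeltaE) -bop_compZr -bop_compBr.
  exact: opnorm_comp.
- by move=> t t0; apply: (local_lower_bound norm_dot B_pos d0 dl tail t0).
Qed.
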